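(* Let $d\ge 2$ and let $G$ be a $d$-regular graph of girth $g(G)\ge 8$. Then $G$ realizes the sequence $(d^d,1)$, i.e. the sequence of length $d+1$ whose first $d$ terms all equal $d$ and whose last term is $1$.
   Context: Graphs are finite, simple and connected. The girth $g(G)$ is the length of a shortest cycle of $G$. Given a proper coloring of $G$, a vertex $v$ is a color-dominating vertex (CDV) if its closed neighborhood $N[v]$ contains all colors used in the coloring. A b-coloring is a proper coloring in which every color class contains at least one CDV. $G$ realizes a finite non-increasing sequence $(s_1,\dots,s_k)$ of positive integers if $G$ has a b-coloring with exactly $k$ colors in which, for each $i\in\{1,\dots,k\}$, the $i$th color class contains at least $s_i$ CDVs. *)

(* Defs.v *)
From mathcomp Require Import all_boot.
Set Implicit Arguments.
Unset Strict Implicit.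
Unset Printing Implicit Defensive.

(* A graph is an edge relation e on a finite vertex type T. *)
Section Graphs.
Variables (T : finType) (e : rel T).

Definition simple_graph : Prop := symmetric e /\ irreflexive e.

(* The null graph is not connected. *)
Definition connected_graph : Prop := 0 < #|T| /\ forall x y : T, connect e x y.

Definition neighbors (v : T) : {set T} := [set u | e v u].

Definition closed_neighbors (v : T) : {set T} := v |: neighbors v.

Definition regular (d : nat) : Prop := forall v : T, #|neighbors v| = d.

(* [ucycle] also accepts sequences of size 0 and, by going back and forth
   along an edge, of size 2; these are not cycles of the graph. *)
Definition graph_cycle (p : seq T) : Prop := 3 <= size p /\ ucycle e p.

(* A relation rather than a function, since an acyclic graph has no
   shortest cycle. *)
Definition is_girth (g : nat) : Prop :=
  (exists2 p, graph_cycle p & size p = g) /\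
  (forall p, graph_cycle p -> g <= size p).

Section Colorings.
Variables (k : nat) (c : {ffun T -> 'I_k}).

Definition proper_coloring : Prop := forall u v : T, e u v -> c u != c v.

(* [codom c] is the set of colors actually used. *)
Definition cdv (v : T) : bool := codom c \subset [set c u | u in closed_neighbors v].

Definition class_cdvs (i : 'I_k) : {set T} := [set v | (c v == i) && cdv v].

(* Every color has a CDV, so all k colors are used. *)
Definition b_coloring : Prop :=
  proper_coloring /\ forall i : 'I_k, exists v, v \in class_cdvs i.

End Colorings.

Definition realizes (s : seq nat) : Prop :=
  exists c : {ffun T -> 'I_(size s)},
    b_coloring c /\ forall i : 'I_(size s), nth 0 s i <= #|class_cdvs c i|.

End Graphs.

(* Main.v *)
Require Import Defs.
From mathcomp Require Import all_boot perm zify.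

(** Girth at least 8 makes the ball of radius 3 around a vertex [r] an induced
    tree. Peeling off leaves, one colors this tree with [d + 1] colors so that the
    coloring is injective on the part of each closed neighborhood that lies in it;
    the remaining vertices are then colored greedily. Every vertex of the ball of
    radius 2 has its whole closed neighborhood, of size [d + 1], in the tree, hence
    is a CDV. A color other than that of [r] occurs in the closed neighborhood of
    each of the [d] neighbors of [r], and these neighborhoods share only [r]. *)

Section Graph.

Set Implicit Arguments.
Unset Strict Implicit.
Unset Printing Implicit Defensive.

Variables (T : finType) (e : rel T).
Hypotheses (e_sym : symmetric e) (e_irr : irreflexive e).

Lemma card_closed_neighbors v :
  #|closed_neighbors e v| = #|neighbors e v|.+1.
Proof. by rewrite cardsU1 inE e_irr. Qed.

(** * Short cycles and uniqueness of short paths *)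

Section ShortCycles.
Variable g : nat.
Hypothesis girth_ge : forall p, graph_cycle e p -> g <= size p.

(** The initial segments of the two paths, cut at the first vertex [m] of one that lies on the
    other, close up to a cycle no longer than both paths together. *)
Lemma diverging_paths_girth x y a b p q :
    path e x (a :: p) -> path e x (b :: q) ->
    uniq (x :: a :: p) -> uniq (x :: b :: q) ->
    last a p = y -> last b q = y -> a != b ->
  g <= size (a :: p) + size (b :: q).
Proof.
set P := a :: p; set Q := b :: q => eP eQ uP uQ lP lQ ab.
have hasPQ : has (mem Q) P.
  apply/hasP; exists y; first by rewrite -lP mem_last.
  by rewrite /= -lQ mem_last.
(* As the first steps differ, [m] cannot come right after [x] on both paths; hence the cycle has at
   least 3 vertices. *)
have: head x P != head x Q by [].
clearbody P Q.
move: eP uP; case: (split_find hasPQ) => m p1 p2 /= mQ p1Q.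
rewrite mem_cat cat_path cat_uniq negb_or rcons_uniq mem_rcons inE negb_or.
case/andP=> ep1 _ /and3P[/andP[/andP[xm xp1] _] /andP[mp1 up1] _] hd.
move: eQ uQ p1Q hd; case: (path.splitP mQ) => q1 q2.
rewrite /= mem_cat cat_path cat_uniq negb_or rcons_uniq mem_rcons inE negb_or.
case/andP=> eq1 _ /and3P[/andP[/andP[_ xq1] _] /andP[mq1 uq1] _] p1q1 hd.
have cyc : graph_cycle e (x :: rcons p1 m ++ rev q1).
  split.
    rewrite /= size_cat size_rcons size_rev; move: hd.
    by case: (p1) => [|? ?]; case: (q1) => [|? ?] //=; rewrite ?eqxx // => _; lia.
  apply/andP; split.
    rewrite /= rcons_cat cat_path last_rcons ep1 /=.
    have := rev_path e x (rcons q1 m).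
    rewrite last_rcons belast_rcons rev_cons => ->.
    by rewrite (@eq_path _ _ e) // => ? ?; rewrite e_sym.
  rewrite /= mem_cat mem_rcons inE mem_rev !negb_or xm xp1 xq1 /=.
  rewrite cat_uniq rcons_uniq mp1 up1 rev_uniq uq1 /= andbT.
  apply/hasPn => z; rewrite mem_rev mem_rcons inE negb_or => zq1.
  apply/andP; split; first by apply: contraNneq mq1 => <-.
  apply: contra p1q1 => zp1; apply/hasP; exists z => //=.
  by rewrite mem_cat mem_rcons inE zq1 orbT.
apply: leq_trans (girth_ge cyc) _.
rewrite /= !size_cat !size_rcons size_rev; lia.
Qed.

(** Neither path properly extends the other, since it would visit the common endpoint twice. So
    distinct paths diverge after a common initial part, and the remainders are too short for the
    girth. *)
Lemma short_path_unique x p q :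
    path e x p -> path e x q -> uniq (x :: p) -> uniq (x :: q) ->
    last x p = last x q -> size p + size q < g ->
  p = q.
Proof.
elim: p x q => [|a p IHp] x [|b q] //.
- move=> _ _ _ /andP[xq _] /= xE; case/negP: xq; rewrite xE; exact: mem_last.
- move=> _ _ /andP[xp _] _ /= xE; case/negP: xp; rewrite -xE; exact: mem_last.
have [<-|ab] := eqVneq a b.
  move=> /andP[_ ep] /andP[_ eq] /andP[_ up] /andP[_ uq] lpq /= sz.
  by rewrite (IHp a q) //; lia.
move=> ep eq up uq lpq; rewrite ltnNge.
by rewrite (diverging_paths_girth ep eq up uq erefl (esym lpq) ab).
Qed.

End ShortCycles.

(** * Balls around a vertex *)

Section Ball.
Variable r : T.

Fixpoint ball n : {set T} :=
  if n is n'.+1 then \bigcup_(x in ball n') closed_neighbors e x else [set r].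

Lemma closed_neighbors_ball n x y :
  x \in ball n -> y \in closed_neighbors e x -> y \in ball n.+1.
Proof. by move=> xn yx; apply/bigcupP; exists x. Qed.

Lemma ballS n : ball n \subset ball n.+1.
Proof.
by apply/subsetP => x xn; apply: (closed_neighbors_ball xn); rewrite setU11.
Qed.

Lemma center_ball n : r \in ball n.
Proof. by elim: n => [|n IHn]; [rewrite set11 | apply: (subsetP (ballS n))]. Qed.

Lemma path_ball n p : path e r p -> size p <= n -> last r p \in ball n.
Proof.
elim: n p => [|n IHn] p; first by case: p => //= _ _; rewrite set11.
case/lastP: p => [|p x]; first by rewrite center_ball.
rewrite rcons_path last_rcons size_rcons => /andP[ep ex] sz.
by apply: closed_neighbors_ball (IHn _ ep sz) _; rewrite !inE ex orbT.
Qed.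

Lemma ball_path n x : x \in ball n ->
  exists p, [/\ path e r p, uniq (r :: p), last r p = x & size p <= n].
Proof.
move=> xn.
have [p [ep <- sz]] : exists p, [/\ path e r p, last r p = x & size p <= n].
  elim: n x xn => [|n IHn] x; first by rewrite inE => /eqP->; exists [::].
  case/bigcupP=> y /IHn[p [ep lp sz]]; rewrite !inE => /predU1P[->|yx].
    by exists p; split=> //; apply: leqW.
  by exists (rcons p x); rewrite rcons_path last_rcons size_rcons ep lp.
case/shortenP: ep => q eq uq /(uniq_leq_size (proj2 (andP uq))) qp.
by exists q; split=> //; apply: leq_trans sz.
Qed.

Variable g : nat.
Hypothesis girth_ge : forall p, graph_cycle e p -> g <= size p.

(* A vertex [x] of [B] at maximal distance from [r] is a leaf: if a path from [r]
   to a neighbor [y] of [x] ran through [x], then [x] would be closer to [r] than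
   [y]; hence it extends to a path to [x], whose last but one vertex is unique. *)
Lemma ball_leaf n (B : {set T}) :
    n.*2.+1 < g -> B \subset ball n -> B != set0 ->
  exists2 x, x \in B & #|neighbors e x :&: B| <= 1.
Proof.
elim: n => [|n IHn] ng Bn B0.
  case/set0Pn: (B0) => x xB; exists x => //.
  rewrite (leq_trans (subset_leq_card (subsetIr _ _))) // -(cards1 r).
  exact: subset_leq_card.
have [Bn'|/subsetPn[x xB xn]] := boolP (B \subset ball n).
  by apply: IHn => //; lia.
have [p [ep up lp szp]] := ball_path (subsetP Bn x xB).
exists x => //.
have parent y : y \in neighbors e x :&: B -> y = last r (belast r p).
  rewrite !inE => /andP[xy yB].
  have [q [eq uq lq szq]] := ball_path (subsetP Bn y yB).
  have xq : x \notin r :: q.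
    apply: contra xn => xq; move: eq lq szq; case/splitPl: xq => q1 q2 q1x.
    rewrite cat_path last_cat size_cat => /andP[eq1 _].
    case: q2 => [/= q1y|? ? /= _ sz].
      by move: xy; rewrite -q1y q1x e_irr.
    by rewrite -q1x; apply: path_ball => //; lia.
  (* The two paths have lengths at most [n.+1] and [n.+2]; their sum [n.+1.*2.+1] explains the bound
     on [g]. *)
  have -> : p = rcons q x.
    apply: (short_path_unique girth_ge ep) => //.
    - by rewrite rcons_path eq lq e_sym.
    - by rewrite -rcons_cons rcons_uniq xq.
    - by rewrite last_rcons.
    - rewrite size_rcons; lia.
  by rewrite belast_rcons /= lq.
by apply/card_le1_eqP => y z /parent-> /parent->; done.
Qed.

(** Otherwise there would be two distinct paths from [r] to [w], through [u] and through [v], each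
    of length at most 2. *)
Lemma neighbors_share_center u v w : 4 < g ->
    u \in neighbors e r -> v \in neighbors e r ->
    w \in closed_neighbors e u -> w \in closed_neighbors e v -> w != r ->
  u = v.
Proof.
move=> g4 ru rv wu wv wr.
(* The path stops at [x] if [w] is [x] itself. *)
pose P x := x :: if w == x then [::] else [:: w].
suff: P u = P v by case.
have PP x : x \in neighbors e r -> w \in closed_neighbors e x ->
    [/\ path e r (P x), uniq (r :: P x), last r (P x) = w & size (P x) <= 2].
  rewrite /P !inE => rx /predU1P[->|xw].
    rewrite eqxx /= rx inE; split=> //.
    by rewrite andbT; apply: contraTneq rx => ->; rewrite e_irr.
  have wx : w != x by apply: contraTneq xw => ->; rewrite e_irr.
  rewrite (negbTE wx) /= rx xw !inE !(eq_sym _ w) negb_or wr wx; split=> //=.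
  by rewrite !andbT; apply: contraTneq rx => ->; rewrite e_irr.
have [eu uu lu szu] := PP u ru wu; have [ev uv lv szv] := PP v rv wv.
apply: (short_path_unique girth_ge eu ev uu uv); first by rewrite lu.
exact: leq_ltn_trans (leq_add szu szv) g4.
Qed.

End Ball.

(** * Coloring forests and extending partial colorings *)

Section Extension.
Variable k : nat.

Lemma free_color (c : {ffun T -> 'I_k}) (S : {set T}) :
  #|S| < k -> exists i, forall x, x \in S -> c x != i.
Proof.
move=> Sk.
have /subsetPn[i _ iS] : ~~ (setT \subset c @: S).
  apply: contraL Sk => /subset_leq_card; rewrite cardsT card_ord -leqNgt => kS.
  exact: leq_trans kS (leq_imset_card _ _).
by exists i => x xS; apply: contraNneq iS => <-; apply: imset_f.
Qed.

(** The last hypothesis encodes that [A] induces a forest. By induction on the size of [A], a vertex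
    [x] with at most one neighbor in [A] is removed and colored last. *)
Lemma forest_coloring (A : {set T}) :
    0 < k -> (forall v, #|closed_neighbors e v| <= k) ->
    (forall B : {set T}, B \subset A -> B != set0 ->
      exists2 x, x \in B & #|neighbors e x :&: B| <= 1) ->
  exists c : {ffun T -> 'I_k},
    {in A, forall v, {in closed_neighbors e v :&: A &, injective c}}.
Proof.
move=> k0 Nk; have [n] := ubnP #|A|; elim: n A => // n IHn A An forest.
have [->|A0] := eqVneq A set0.
  by exists [ffun=> Ordinal k0] => v; rewrite inE.
have [x xA leaf] := forest A (subxx _) A0.
have [||c cP] := IHn (A :\ x).
- by move: An; rewrite (cardsD1 x) xA.
- by move=> B BA; apply: forest; apply: subset_trans BA _; rewrite subD1set.
(* [S] contains all vertices whose color [x] must avoid. If [x] has a neighbor [y] in [A], these lie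
   in the closed neighborhood of [y] without [x], so fewer than [k] colors are blocked. *)
pose S := \bigcup_(y in neighbors e x :&: A) (closed_neighbors e y :\ x).
have Sk : #|S| < k.
  have [N0|[y yN]] := set_0Vmem (neighbors e x :&: A).
    by rewrite /S N0 big_set0 cards0.
  have Ny : neighbors e x :&: A = [set y].
    by apply/eqP; rewrite eq_sym eqEcard sub1set yN cards1.
  rewrite /S Ny big_set1; apply: leq_trans (Nk y).
  rewrite (cardsD1 x (closed_neighbors e y)).
  have -> : x \in closed_neighbors e y.
    by move: yN; rewrite !inE => /andP[]; rewrite e_sym => ->; rewrite orbT.
  by rewrite add1n.
have [i iP] := free_color c Sk.
pose c' := [ffun y => if y == x then i else c y].
have fresh v y : v \in A -> x \in closed_neighbors e v :&: A ->
    y \in closed_neighbors e v :&: A -> y != x -> c y != i.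
  rewrite !inE => vA /andP[xv _] /andP[yv yA] yx; apply: iP.
  have [vx|vx] := eqVneq v x.
    apply/bigcupP; exists y; rewrite !inE ?eqxx ?yx //.
    by move: yv; rewrite vx (negbTE yx) yA /= => ->.
  apply/bigcupP; exists v; rewrite !inE ?vA ?yx ?yv // andbT.
  by move: xv; rewrite eq_sym (negbTE vx) e_sym.
exists c' => v vA y z yv zv; rewrite !ffunE.
have [yx|yx] := eqVneq y x; have [zx|zx] := eqVneq z x.
- by rewrite yx zx.
- by rewrite yx in yv; move=> ic; case/eqP: (fresh v z vA yv zv zx).
- by rewrite zx in zv; move=> ic; case/eqP: (fresh v y vA zv yv yx).
(* Away from [x] the old coloring suffices; around [x] itself, [y] and [z] are both its only
   neighbor in [A]. *)
have [vx|vx] := eqVneq v x; last first.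
  apply: (cP v); first by rewrite !inE vx.
    by move: yv; rewrite !inE yx.
  by move: zv; rewrite !inE zx.
move: yv zv; rewrite vx !inE (negbTE yx) (negbTE zx) /= => xy xz _.
by apply: (card_le1_eqP leaf); rewrite !inE.
Qed.

(** The values of [c] outside [A] are placeholders. They are replaced one vertex at a time, each
    vertex having too few neighbors to block all [k] colors. *)
Lemma greedy_extension (A : {set T}) (c : {ffun T -> 'I_k}) :
    (forall v, #|neighbors e v| < k) ->
    {in A &, forall u v, e u v -> c u != c v} ->
  exists2 c' : {ffun T -> 'I_k}, proper_coloring e c' & {in A, c' =1 c}.
Proof.
move=> Nk; have [n] := ubnP #|~: A|; elim: n A c => // n IHn A c An cA.
have [AC|[x]] := set_0Vmem (~: A).
  by exists c => // u v; apply: cA; rewrite -(setCK A) AC setC0 inE.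
move=> xA; have [i iP] := free_color c (Nk x).
pose c1 := [ffun y => if y == x then i else c y].
have [||c' c'P c'c1] := IHn (x |: A) c1.
- move: An; rewrite (cardsD1 x (~: A)) xA.
  by rewrite setCU setIC -setDE.
- move=> u v; rewrite !inE !ffunE.
  have [->|ux] := eqVneq u x; have [->|vx] := eqVneq v x => //= uA vA uv.
  + by rewrite e_irr in uv.
  + by rewrite eq_sym iP ?inE.
  + by rewrite iP ?inE // e_sym.
  + exact: cA.
exists c' => // u uA; rewrite c'c1 ?inE ?uA ?orbT // ffunE.
by case: eqP uA xA => // ->; rewrite !inE => ->.
Qed.

Lemma injective_cdv (c : {ffun T -> 'I_k}) v :
    #|closed_neighbors e v| = k -> {in closed_neighbors e v &, injective c} ->
  (forall i, exists2 w, w \in closed_neighbors e v & c w = i) /\ cdv e c v.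
Proof.
move=> Nk cI.
have NT : c @: closed_neighbors e v = setT.
  by apply/eqP; rewrite eqEcard subsetT card_in_imset // Nk cardsT card_ord /=.
split=> [i|]; last by apply/subsetP => i _; rewrite NT inE.
have : i \in c @: closed_neighbors e v by rewrite NT inE.
by case/imsetP=> w wv ->; exists w.
Qed.

End Extension.

(** * The coloring around a root, and the theorem *)

Lemma girth8_coloring d r :
    regular e d -> (forall p, graph_cycle e p -> 8 <= size p) ->
  exists c : {ffun T -> 'I_d.+1},
    [/\ b_coloring e c, c r = ord_max, cdv e c r
      & forall i, i != ord_max -> d <= #|class_cdvs e c i|].
Proof.
move=> reg girth_ge.
have Nd v : #|closed_neighbors e v| = d.+1 by rewrite card_closed_neighbors reg.
have [||B BA B0|c0 c0P] := @forest_coloring d.+1 (ball r 3) => //.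
- by move=> v; rewrite Nd.
(* Radius 3 requires 2 * 3 + 1 < 8, which is where girth 8 enters. *)
- exact: (ball_leaf girth_ge _ BA B0).
(* Swapping two colors gives [r] the last one, whose class needs only a single CDV. *)
pose c1 := [ffun v => tperm (c0 r) ord_max (c0 v)].
have c1P : {in ball r 3, forall v,
    {in closed_neighbors e v :&: ball r 3 &, injective c1}}.
  by move=> v vA y z yv zv; rewrite !ffunE => /perm_inj; apply: c0P vA y z yv zv.
have [v|u v uA vA uv|c cP cc1] := @greedy_extension d.+1 (ball r 3) c1.
- by rewrite reg.
- apply/eqP => /(c1P u uA) uv_eq; move: (uv).
  by rewrite uv_eq ?e_irr // !inE ?eqxx ?uA ?vA ?uv ?orbT.
have cr : c r = ord_max by rewrite cc1 ?center_ball // ffunE tpermL.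
have rainbow v : v \in ball r 2 ->
    (forall i, exists2 w, w \in closed_neighbors e v & c w = i) /\ cdv e c v.
  move=> v2; apply: injective_cdv => // y z yv zv.
  have [y3 z3] := (closed_neighbors_ball v2 yv, closed_neighbors_ball v2 zv).
  rewrite !cc1 //; apply: (c1P v); first exact: (subsetP (ballS r 2)).
    by rewrite in_setI yv y3.
  by rewrite in_setI zv z3.
have [r_all r_cdv] := rainbow r (center_ball r 2).
exists c; split=> //.
  (* The closed neighborhood of [r] shows every color and consists of CDVs, as it lies within radius
     2. *)
  split=> // i; have [w wr <-] := r_all i; exists w; rewrite inE eqxx /=.
  case: (rainbow w) => //; apply: (subsetP (ballS r 1)).
  by apply: closed_neighbors_ball wr; rewrite set11.
move=> i ir.
(* [f u] is a vertex of color [i] near [u]; the default never occurs for a neighbor [u] of [r]. *)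
pose f u := odflt u [pick w in closed_neighbors e u | c w == i].
have ball1 u : u \in neighbors e r -> u \in ball r 1.
  rewrite inE => ru; apply: (@closed_neighbors_ball r 0 r); first exact: set11.
  by rewrite !inE ru orbT.
have fP u : u \in neighbors e r -> f u \in closed_neighbors e u /\ c (f u) = i.
  move=> ru; rewrite /f; case: pickP => [w /andP[wu /eqP]|none] //.
  have [|/(_ i)[w wu wi] _] := rainbow u.
    exact: (subsetP (ballS r 1)) (ball1 u ru).
  by have := none w; rewrite wu wi eqxx.
have fI : {in neighbors e r &, injective f}.
  move=> u v ru rv fuv; have [[fu ci] [fv _]] := (fP u ru, fP v rv).
  apply: (neighbors_share_center girth_ge) ru rv fu _ _ => //.
    by rewrite fuv.
  (* The shared vertex has color [i], so it is not [r]. *)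
  by apply: contraNneq ir => fr; rewrite -cr -fr ci.
rewrite -{1}(reg r) -(card_in_imset fI); apply: subset_leq_card.
apply/subsetP => w /imsetP[u ru ->]; have [fu ci] := fP u ru.
rewrite inE ci eqxx /=; apply: (rainbow _ _).2.
exact: closed_neighbors_ball (ball1 u ru) fu.
Qed.

End Graph.

Theorem theorem5p6 (T : finType) (e : rel T) (d g : nat)
  (e_simple : simple_graph e) (e_connected : connected_graph e)
  (d_ge2 : 2 <= d) (e_regular : regular e d)
  (e_girth : is_girth e g) (g_ge8 : 8 <= g) :
  realizes e (rcons (nseq d d) 1).
Proof.
have [e_sym e_irr] := e_simple.
have [/card_gt0P[r _] _] := e_connected.
have girth_ge p : graph_cycle e p -> 8 <= size p.
  by move/(proj2 e_girth); apply: leq_trans.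
have [c [bc cr r_cdv cD]] := girth8_coloring e_sym e_irr r e_regular girth_ge.
rewrite /realizes.
have: size (rcons (nseq d d) 1) = d.+1 by rewrite size_rcons size_nseq.
(* The length of the sequence occurs in the type of the coloring, so it is generalized before [d.+1]
   replaces it. *)
move: (size _) => k k_d; rewrite k_d; exists c; split=> // i.
rewrite nth_rcons size_nseq nth_nseq.
have [i_max|i_max] := eqVneq i ord_max.
  rewrite i_max /= ltnn eqxx card_gt0; apply/set0Pn; exists r.
  by rewrite inE cr eqxx.
have i_lt : i < d by rewrite ltn_neqAle i_max -ltnS ltn_ord.
by rewrite i_lt cD.
Qed.
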